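(* There are absolute constants $c,C>0$ such that for every finite set $A$ of positive real numbers and every $K\geq 1$ with $|AA| \leq K|A|$, \[ |(A+1)(A+1)(A+1)| \gg \frac{|A|^{2+c}}{K^C}, \] where the implied constant is absolute.
   Context: $AA=\{ab:a,b\in A\}$, $A+1=\{a+1:a\in A\}$, and $(A+1)(A+1)(A+1)=\{xyz:x,y,z\in A+1\}$. *)

(* Defs.v *)
From HB Require Import structures.
From mathcomp Require Import all_boot all_order all_algebra.
From mathcomp Require Import finmap.
From mathcomp Require Import all_classical all_reals all_analysis.
From mathcomp Require Import Rstruct Rstruct_topology.
From Stdlib Require Rdefinitions.
Notation R := Rdefinitions.R.
Set Implicit Arguments. Unset Strict Implicit. Unset Printing Implicit Defensive.
Import Order.TTheory GRing.Theory Num.Theory.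
Local Open Scope ring_scope.


Definition prodset (A B : {fset R}) : {fset R} := [fset (a * b)%R | a in A, b in B]%fset.
Definition shift1 (A : {fset R}) : {fset R} := [fset (a + 1)%R | a in A]%fset.

(* Main.v *)
(* Write S = A + 1.  Two facts force growth.

   (1) |SS| is nearly |A|^2.  A solution of (a+1)(b+1) = (c+1)(d+1) says that
   (a,c), (d,b) and (-1,-1) are collinear.  Scaling the coordinates by any
   (h,h') in A x A keeps the three points in the grid Q x Q with
   Q = AA u (-A), so |A|^2 times the multiplicative energy of S is at most the
   number of collinear triples of a grid of side O(K|A|), which is
   O(K^4 |A|^4 log |A|) by the Szemeredi-Trotter bound for rich lines.

   (2) |SSSS/SSS| >> |A|^3 / K^7.  As A has small doubling, every block of O(K)
   consecutive elements of A contains x < dx such that d is a popular ratio.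
   For z < x the products (x+1) G(z), where G(z) = (dz+1)/(z+1), are squeezed
   between x+1 and dx+1.  The ratios G(ez)/G(z) are again monotone in z, so the
   same squeezing between consecutive values of G gives |A|^2 products per block.

   If |SSS| were at most |A|^(2+c), then X = SS would satisfy |XS| <= alpha |X|
   with alpha small by (1), and Pluennecke's inequality would give
   |SSSS/SSS| <= alpha^7 |X|, against (2). *)
Require Import Defs.
From HB Require Import structures.
From mathcomp Require Import all_boot all_order all_algebra.
From mathcomp Require Import finmap.
From mathcomp Require Import all_classical all_reals all_analysis.
From mathcomp Require Import Rstruct Rstruct_topology.
From mathcomp Require Import zify ring lra.
From Stdlib Require Rdefinitions.
Set Implicit Arguments. Unset Strict Implicit. Unset Printing Implicit Defensive.
Import Order.TTheory GRing.Theory Num.Theory.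
Local Open Scope ring_scope.

(** * Product sets of finite sets *)

Definition mulfs (F : realFieldType) (A B : {fset F}) : {fset F} :=
  [fset a * b | a in A, b in B]%fset.

Lemma mem_mulfs (F : realFieldType) (A B : {fset F}) a b :
  a \in A -> b \in B -> a * b \in mulfs A B.
Proof. by move=> aA bB; apply/imfset2P; exists a => //; exists b. Qed.

Lemma mulfsP (F : realFieldType) (A B : {fset F}) x :
  reflect (exists a b, [/\ a \in A, b \in B & x = a * b]) (x \in mulfs A B).
Proof.
apply: (iffP (imfset2P _ _ _ _ _)) => [[a aA [b bB ->]]|[a [b [aA bB ->]]]].
  by exists a, b.
by exists a => //; exists b.
Qed.

Lemma mulfs_sub (F : realFieldType) (A B A' B' : {fset F}) :
  {subset A <= A'} -> {subset B <= B'} -> {subset mulfs A B <= mulfs A' B'}.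
Proof.
move=> AA BB x /mulfsP[a [b [aA bB ->]]]; apply/mulfsP; exists a, b; split=> //.
  exact: AA.
exact: BB.
Qed.

Lemma mulfsC (F : realFieldType) (A B : {fset F}) : mulfs A B = mulfs B A.
Proof.
apply/fsetP => x; apply/mulfsP/mulfsP => -[a [b [aA bB ->]]];
by exists b, a; split => //; rewrite mulrC.
Qed.

Lemma mulfsA (F : realFieldType) (A B C : {fset F}) :
  mulfs A (mulfs B C) = mulfs (mulfs A B) C.
Proof.
apply/fsetP => x; apply/mulfsP/mulfsP.
  move=> [a [d [aA /mulfsP[b [c [bB cC ->]]] ->]]].
  by exists (a * b), c; split; rewrite ?mulrA //; apply/mulfsP; exists a, b.
move=> [d [c [/mulfsP[a [b [aA bB ->]]] cC ->]]].
by exists a, (b * c); split; rewrite ?mulrA //; apply/mulfsP; exists b, c.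
Qed.

Lemma card_subset (K : choiceType) (A B : {fset K}) :
  {subset A <= B} -> (#|` A| <= #|` B|)%N.
Proof. by move=> AB; apply/fsubset_leq_card/fsubsetP. Qed.

Lemma card_mulfs_ge (F : realFieldType) (A B : {fset F}) (b : F) :
  b != 0 -> b \in B -> (#|` A| <= #|` mulfs A B|)%N.
Proof.
move=> b0 bB; have <- : #|` [fset a * b | a in A]%fset| = #|` A|.
  by apply: card_imfset => x y /(mulIf b0).
by apply: card_subset => x /imfsetP[a /= aA ->]; apply/mulfsP; exists a, b.
Qed.

(** * Popular ratios and squeezing into disjoint intervals *)

Lemma sort_fset_lt_sorted (F : realDomainType) (Z : {fset F}) :
  sorted <%R (sort <=%R (enum_fset Z)).
Proof. by rewrite lt_sorted_uniq_le sort_uniq fset_uniq sort_le_sorted. Qed.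

Definition shiftfs (F : realFieldType) (A : {fset F}) : {fset F} :=
  [fset (a + 1)%R | a in A]%fset.

(** Cutting [s] into [k] consecutive blocks of length [M] gives [k] intervals. They are disjoint
    because [f] is increasing, so their points of [W] add up. *)
Lemma interval_packing (F : realDomainType) (f : F -> F) (W s : seq F)
    (M Q k : nat) :
  sorted <%R s -> {in s &, {homo f : x y / x < y}} -> (k * M <= size s)%N ->
  (forall J, subseq J s -> size J = M -> exists x y,
     [/\ x \in J, y \in J, x < y & (Q <= count (fun w => (f x < w < f y)%R) W)%N]) ->
  (k * Q <= size W)%N.
Proof.
move=> s_sorted fs sz hJ; rewrite -(count_predT W).
(* The induction counts only points satisfying a predicate that holds above the image of [s]. For
   the tail this predicate is [f y < w], which excludes the first interval. *)
suff: forall p : pred F, (forall x w, x \in s -> f x < w -> p w) ->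
    (k * Q <= count p W)%N by apply.
elim: k s s_sorted fs sz hJ => [|k IHk] s s_sorted fs sz hJ p hp.
  by rewrite mul0n.
have szM : size (take M s) = M by rewrite size_take_min; lia.
have [x [y [xJ yJ xy hQ]]] := hJ _ (take_subseq s M) szM.
have ys : y \in s by apply: mem_take yJ.
have xs : x \in s by apply: mem_take xJ.
have yd z : z \in drop M s -> y < z.
  move=> zd; move: s_sorted; rewrite lt_sorted_pairwise -{1}(cat_take_drop M s).
  by rewrite pairwise_cat => /andP[/allrelP + _]; apply.
have /IHk H : sorted <%R (drop M s) by apply: drop_sorted.
have {}H : (k * Q <= count (fun w => (f y < w)%R) W)%N.
  apply: H.
  - by move=> u v /mem_drop us /mem_drop vs; apply: fs.
  - by rewrite size_drop; lia.
  - by move=> J Js; apply: hJ; apply: subseq_trans Js (drop_subseq _ _).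
  - by move=> u w ud; apply: lt_trans; apply: fs => //; [apply: mem_drop ud|apply: yd].
rewrite mulSn; apply: leq_trans (leq_add hQ H) _.
rewrite -count_predUI [X in (_ + X)%N](_ : _ = 0%N) ?addn0.
  apply: sub_count => w /= /orP[/andP[xw _]|yw]; [exact: hp xw|exact: hp yw].
apply/eqP; rewrite -leqn0 leqNgt -has_count; apply/hasPn => w _ /=.
by apply/negP => /andP[/andP[_ a] b]; have := lt_trans a b; rewrite ltxx.
Qed.

Lemma card_fsetI_bigcup_le (K : choiceType) (I : Type) (r : seq I) (V : {fset K})
    (U : I -> {fset K}) :
  (#|` V `&` \bigcup_(i <- r) U i| <= \sum_(i <- r) #|` V `&` U i|)%fset%N.
Proof.
elim/big_rec2: _ => [|i m B _ le]; first by rewrite fsetI0 cardfs0.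
rewrite fsetIUr; apply: leq_trans (_ : _ <= #|` V `&` U i|%fset + #|` V `&` B|%fset)%N _.
  by rewrite cardfsU leq_subr.
by rewrite leq_add2l.
Qed.

(** The dilates x Z with x in [J] all lie in [T], and x Z meets y Z in as many points as there are z
    in [Z] with (y / x) z in [Z]. If every such intersection were below |Z| / M, the union of the
    dilates would be too large for [T]. *)
Lemma popular_ratio (F : realFieldType) (Z T : {fset F}) (J : seq F) :
  sorted <%R J -> (forall x, x \in J -> 0 < x) ->
  (forall x z, x \in J -> z \in Z -> x * z \in T) ->
  (0 < size J)%N -> (0 < #|` Z|)%N -> (2 * #|` T| <= size J * #|` Z|)%N ->
  exists x y, [/\ x \in J, y \in J, x < y &
    (#|` Z| <= size J * #|` [fset z in Z | (y / x * z)%R \in Z]%fset|)%N].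
Proof.
move=> Js Jpos JT J0 Z0 hT; set M := size J in hT J0 *.
pose P x y := (x < y) && (#|` Z| <= M * #|` [fset z in Z | (y / x * z)%R \in Z]%fset|)%N.
case: (boolP (has (fun x => has (P x) J) J)) => [/hasP[x xJ /hasP[y yJ /andP[xy h]]]|].
  by exists x, y.
move=> /hasPn none; exfalso.
have {}none x y : x \in J -> y \in J -> x < y ->
    (M * #|` [fset z in Z | (y / x * z)%R \in Z]%fset| <= #|` Z|)%N.
  move=> xJ yJ xy; move: (none x xJ) => /hasPn/(_ y yJ).
  by rewrite /P xy /= -ltnNge => /ltnW.
pose U x := [fset x * z | z in Z]%fset.
pose V J' := (\bigcup_(x <- J') U x)%fset.
have cardU x : 0 < x -> #|` U x| = #|` Z|.
  by move=> x0; apply: card_imfset => a b /(mulfI (lt0r_neq0 x0)).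
(* Bonferroni's inequality for the union of the dilates over [J'], cleared of denominators by the
   factor [2 * M]. *)
have sub J' : subseq J' J -> (2 * M * size J' * #|` Z| <=
    2 * M * #|` V J'| + size J' * (size J').-1 * #|` Z|)%N.
  elim: J' => [|x J' IH] J'J; first by rewrite !muln0.
  have J'J' : subseq J' J by apply: subseq_trans J'J; apply: subseq_cons.
  have xJ : x \in J by apply: (mem_subseq J'J); rewrite inE eqxx.
  have xJ' y : y \in J' -> x < y.
    move: (subseq_sorted lt_trans J'J Js); rewrite /= (path_sortedE lt_trans).
    by move=> /andP[/allP + _]; apply.
  have int : (M * #|` U x `&` V J'|%fset <= size J' * #|` Z|)%N.
    apply: leq_trans (leq_mul (leqnn M) (card_fsetI_bigcup_le _ _ _)) _.
    rewrite big_distrr /= -sum1_size big_distrl /= !big_seq.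
    apply: leq_sum => y yJ'; rewrite mul1n.
    have yJ : y \in J by apply: (mem_subseq J'J').
    apply: leq_trans (none x y xJ yJ (xJ' y yJ')); rewrite leq_mul2l; apply/orP; right.
    apply: (@leq_trans #|` [fset (y * z)%R | z in
        [fset z in Z | (y / x * z)%R \in Z]]|%fset); last first.
      by rewrite card_imfset //= => a b /(mulfI (lt0r_neq0 (Jpos y yJ))).
    apply: fsubset_leq_card; apply/fsubsetP => w /fsetIP[/imfsetP[z1 /= z1Z ->] /imfsetP[z /= zZ e]].
    apply/imfsetP; exists z => //=; rewrite !inE /= zZ.
    by rewrite mulrAC -e mulrAC divff ?mul1r // gt_eqF ?Jpos.
  have := IH J'J'; rewrite /V big_cons cardfsU cardU ?Jpos // -/(V J') /=.
  have : (#|` U x `&` V J'|%fset <= #|` Z|)%N.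
    by rewrite -(cardU x) ?Jpos //; apply/fsubset_leq_card/fsubsetIl.
  move: int; case: (size J') => [|j] /=; nia.
have := sub J (subseq_refl J).
have : (#|` V J| <= #|` T|)%N.
  apply: fsubset_leq_card; apply/bigfcupsP => x xJ _; apply/fsubsetP => w.
  by move=> /imfsetP[z /= zZ ->]; apply: JT.
rewrite -/M; move: J0 Z0 hT; clear.
move: M #|` V J| #|` T| #|` Z| => M v t z; case: M => // M _ z0 h h'.
nia.
Qed.

Lemma fset_halves (F : realDomainType) (Z : {fset F}) :
  exists Zl Zu : {fset F},
  [/\ {subset Zl <= Z}, {subset Zu <= Z}, (forall x y, x \in Zl -> y \in Zu -> x < y) &
   (#|` Z|./2 <= #|` Zl|)%N /\ (#|` Z|./2 <= #|` Zu|)%N].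
Proof.
pose s := sort <=%R (enum_fset Z); have us : uniq s by rewrite sort_uniq fset_uniq.
have ss : sorted <%R s by rewrite lt_sorted_uniq_le us sort_le_sorted.
have szs : size s = #|` Z| by rewrite size_sort.
have ms x : (x \in s) = (x \in Z) by rewrite mem_sort.
exists [fset x in take #|` Z|./2 s]%fset, [fset x in drop #|` Z|./2 s]%fset; split.
- by move=> x; rewrite !inE => /mem_take; rewrite ms.
- by move=> x; rewrite !inE => /mem_drop; rewrite ms.
- move=> x y; rewrite !inE => xl yu.
  move: ss; rewrite lt_sorted_pairwise -{1}(cat_take_drop #|` Z|./2 s).
  by rewrite pairwise_cat => /andP[/allrelP + _]; apply.
- rewrite !card_fseq !undup_id ?take_uniq ?drop_uniq // size_take_min size_drop szs.
  by lia.
Qed.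

(** A block of [Z1] contains x < y whose ratio e = y / x is popular in [Z0]. Each z in [Z0] with e z
    in [Z0] gives the point c G(x) G(e z) / G(z) strictly between c G(x) and c G(y), and distinct z
    give distinct points. Packing these intervals over the [k] blocks yields the count. *)
Lemma squeeze_count (F : realFieldType) (G : F -> F) (c lo hi : F)
    (Z1 Z0 : {fset F}) (W : seq F) (M k q : nat) :
  0 < c ->
  (forall x, x \in Z1 -> 0 < x) -> (forall x, x \in Z0 -> 0 < x) ->
  (forall x, x \in Z1 -> 0 < G x) -> (forall x, x \in Z0 -> 0 < G x) ->
  {in Z1 &, {homo G : x y / x < y}} -> {in Z0 &, {homo G : x y / x < y}} ->
  (forall e x z, 1 < e -> x \in Z1 -> e * x \in Z1 -> z \in Z0 -> e * z \in Z0 ->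
     G (e * z) / G z < G (e * x) / G x) ->
  (forall e z z', 1 < e -> z \in Z0 -> z' \in Z0 -> e * z \in Z0 -> e * z' \in Z0 ->
     G (e * z) / G z = G (e * z') / G z' -> z = z') ->
  (forall x z z', x \in Z1 -> z \in Z0 -> z' \in Z0 -> c * G x * (G z' / G z) \in W) ->
  (forall x, x \in Z1 -> lo <= c * G x <= hi) ->
  (0 < M)%N -> (0 < #|` Z0|)%N -> (2 * #|` mulfs Z1 Z0| <= M * #|` Z0|)%N ->
  (k * M <= #|` Z1|)%N -> (q * M <= #|` Z0|)%N ->
  (k * q <= count (fun w => (lo < w < hi)%R) W)%N.
Proof.
move=> c0 pZ1 pZ0 pG1 pG0 iG1 iG0 Hsq Hinj HW Hlohi M0 Z00 HT kM qM.
rewrite -size_filter; set W' := seq.filter _ W.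
have memZ1 x : (x \in sort <=%R (enum_fset Z1)) = (x \in Z1) by rewrite mem_sort.
apply: (@interval_packing _ (fun x => c * G x) W' (sort <=%R (enum_fset Z1)) M).
- exact: sort_fset_lt_sorted.
- by move=> x y; rewrite !memZ1 ltr_pM2l //; apply: iG1.
- by rewrite size_sort.
move=> J Js szJ.
have JZ1 x : x \in J -> x \in Z1 by move=> /(mem_subseq Js); rewrite memZ1.
have [||||||x [y [xJ yJ xy]]] := @popular_ratio _ Z0 (mulfs Z1 Z0) J; rewrite ?szJ //.
- by apply: (subseq_sorted lt_trans Js); apply: sort_fset_lt_sorted.
- by move=> x /JZ1; apply: pZ1.
- by move=> x z /JZ1 ? ?; apply: mem_mulfs.
set E := [fset z in Z0 | _]%fset => hE; exists x, y; split => //.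
have xZ := JZ1 _ xJ; have yZ := JZ1 _ yJ; have x0 := pZ1 _ xZ.
have e1 : 1 < y / x by rewrite ltr_pdivlMr // mul1r.
have ey : y / x * x = y by rewrite divfK ?gt_eqF.
have EP z : z \in E -> z \in Z0 /\ y / x * z \in Z0.
  by rewrite !inE /= => /andP[-> ->].
have qE : (q <= #|` E|)%N by rewrite -(leq_pmul2r M0) (leq_trans qM) // mulnC.
apply: leq_trans qE _; rewrite -size_filter.
rewrite -(size_map (fun z => c * G x * (G (y / x * z) / G z))).
apply: uniq_leq_size.
  rewrite map_inj_in_uniq ?fset_uniq // => z z' /EP[zZ ezZ] /EP[z'Z ez'Z].
  move=> /mulfI; rewrite mulf_neq0 ?gt_eqF ?pG1 // => /(_ isT) h.
  exact: (Hinj (y / x)).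
move=> w /mapP[z /EP[zZ ezZ] ->].
have cG : 0 < c * G x by rewrite mulr_gt0 ?pG1.
(* The lower bound holds because [G] increases from z to e z. The upper bound compares the ratio at
   z with the ratio G(y) / G(x) at x. *)
have gl : c * G x < c * G x * (G (y / x * z) / G z).
  rewrite ltr_pMr // ltr_pdivlMr ?mul1r ?pG0 // iG0 // ltr_pMl //.
  exact: pZ0.
have gu : c * G x * (G (y / x * z) / G z) < c * G y.
  rewrite -mulrA ltr_pM2l // [X in X < _]mulrC -ltr_pdivlMr ?pG1 //.
  by have := Hsq (y / x) x z; rewrite ey; apply.
rewrite !mem_filter gl gu HW //= andbT.
have /andP[l1 _] := Hlohi _ xZ; have /andP[_ h1] := Hlohi _ yZ.
by rewrite (le_lt_trans l1 gl) (lt_le_trans gu h1).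
Qed.

(* The ratio is increasing in [z] before [1 / sqrt (d * e)] and decreasing after. *)
Lemma ratio_monotone (F : realFieldType) (d e z w : F) :
  1 < d -> 1 < e -> 0 < z -> z < w ->
  let G x := (d * x + 1) / (x + 1) in
  (d * (e * w) <= 1 -> G (e * z) / G z < G (e * w) / G w) /\
  (1 <= z -> G (e * w) / G w < G (e * z) / G z).
Proof.
move=> d1 e1 z0 zw G.
have pos (a b : F) : 0 < a -> 0 < b -> 0 < a * b + 1 by move=> ? ?; rewrite addr_gt0 ?mulr_gt0.
have d0 : 0 < d by lra.
have e0 : 0 < e by lra.
have w0 : 0 < w by lra.
have H (x y : F) : 0 < x -> 0 < y -> 0 < (d * e * x * y - 1) * (x - y) ->
    G (e * x) / G x < G (e * y) / G y.
  move=> x0 y0 hxy; have ex0 : 0 < e * x by rewrite mulr_gt0.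
  have ey0 : 0 < e * y by rewrite mulr_gt0.
  rewrite /G -subr_gt0.
  have p1 := pos d x d0 x0; have p2 := pos d y d0 y0.
  have p3 : 0 < e * x + 1 by lra.
  have p4 : 0 < e * y + 1 by lra.
  have p5 : 0 < x + 1 by lra.
  have p6 : 0 < y + 1 by lra.
  have p7 := pos d (e * x) d0 ex0; have p8 := pos d (e * y) d0 ey0.
  (* All factors other than (d e x y - 1)(x - y) are positive, so that one decides which ratio is
     larger. *)
  rewrite (_ : _ - _ = (d - 1) * (e - 1) * ((d * e * x * y - 1) * (x - y)) /
    ((e * x + 1) * (e * y + 1) * (d * x + 1) * (d * y + 1))).
    by rewrite divr_gt0 //; [rewrite (mulr_gt0 _ hxy) // mulr_gt0 // subr_gt0|rewrite !mulr_gt0].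
  field.
  by rewrite !gt_eqF.
split=> h; apply: H => //.
- rewrite mulrC -mulrNN mulr_gt0 //; first by lra.
  rewrite opprB subr_gt0.
  have h1 : w <= e * w by rewrite ler_peMl // ltW.
  have h2 : e * w <= d * (e * w) by rewrite ler_peMl ?mulr_ge0 // ltW.
  rewrite (_ : d * e * z * w = d * (e * w) * z); last by ring.
  by apply: le_lt_trans (ler_piMl (ltW z0) h) _; lra.
- rewrite mulr_gt0 ?subr_gt0 //.
  rewrite -mulrA; apply: mulr_egt1; first exact: mulr_egt1.
  by nra.
Qed.

(** The quotient at x equals d - (d - 1) / (x + 1). *)
Lemma shift_ratio_lt (F : realFieldType) (d x y : F) :
  1 < d -> 0 < x -> x < y -> (d * x + 1) / (x + 1) < (d * y + 1) / (y + 1).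
Proof.
move=> d1 x0 xy; rewrite ltr_pdivrMr; last by lra.
rewrite mulrAC ltr_pdivlMr; last by lra.
nra.
Qed.

(** Two nested squeezes. A block in the upper half of [A] contains x < y = d x with d popular in the
    lower half, so at least [q1] elements z of the lower half have d z there too. For these, (x + 1)
    G(z) lies between x + 1 and y + 1, where G(z) = (d z + 1) / (z + 1). Squeezing again between
    values of G places [k2 * k2] points of [W] in that interval, and the [k1] blocks give disjoint
    intervals. *)
Lemma shifted_products_count (F : realFieldType) (A : {fset F}) (W : seq F)
    (M1 k1 q1 M2 k2 : nat) :
  (forall a, a \in A -> 0 < a) ->
  (forall a, a \in A -> a <= 1) \/ (forall a, a \in A -> 1 <= a) ->
  (forall a1 a2 a3 a4 b1 b2 b3, a1 \in A -> a2 \in A -> a3 \in A -> a4 \in A ->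
     b1 \in A -> b2 \in A -> b3 \in A ->
     (a1 + 1) * (a2 + 1) * (a3 + 1) * (a4 + 1) / ((b1 + 1) * (b2 + 1) * (b3 + 1)) \in W) ->
  (0 < M1)%N -> (0 < M2)%N -> (1 < q1)%N ->
  (2 * #|` mulfs A A| <= M1 * #|` A|./2)%N ->
  (2 * #|` mulfs A A| <= M2 * q1./2)%N ->
  (k1 * M1 <= #|` A|./2)%N -> (q1 * M1 <= #|` A|./2)%N -> (k2 * M2 <= q1./2)%N ->
  (k1 * (k2 * k2) <= size W)%N.
Proof.
move=> pA sideA HW M1_0 M2_0 q1_1 hM1 hM2 hk1 hq1 hk2.
have [Al [Au [AlA AuA Alu [hAl hAu]]]] := fset_halves A.
have memAu x : (x \in sort <=%R (enum_fset Au)) = (x \in Au) by rewrite mem_sort.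
have mulS (X Y : {fset F}) : {subset X <= A} -> {subset Y <= A} ->
    (#|` mulfs X Y| <= #|` mulfs A A|)%N.
  by move=> XA YA; apply/card_subset/mulfs_sub.
apply: (@interval_packing _ (fun x => x + 1) W (sort <=%R (enum_fset Au)) M1).
- exact: sort_fset_lt_sorted.
- by move=> x y _ _; rewrite ltrD2r.
- by rewrite size_sort (leq_trans hk1).
move=> J Js szJ.
have JAu x : x \in J -> x \in Au by move=> /(mem_subseq Js); rewrite memAu.
have [||||||x [y [xJ yJ xy]]] := @popular_ratio _ Al (mulfs Au Al) J; rewrite ?szJ //.
- by apply: (subseq_sorted lt_trans Js); apply: sort_fset_lt_sorted.
- by move=> x /JAu /AuA; apply: pA.
- by move=> x z /JAu ? ?; apply: mem_mulfs.
- by apply: leq_trans hAl; nia.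
- apply: leq_trans (leq_trans hM1 _); last by rewrite leq_mul2l hAl orbT.
  by rewrite leq_mul2l mulS ?orbT.
set D := [fset z in Al | _]%fset => hD; exists x, y; split => //.
have xA := AuA _ (JAu _ xJ); have yA := AuA _ (JAu _ yJ); have x0 := pA _ xA.
set d := y / x in D hD.
have d1 : 1 < d by rewrite ltr_pdivlMr // mul1r.
have ex : d * x = y by rewrite divfK ?gt_eqF.
have DP z : z \in D -> [/\ z \in A, d * z \in A & z < x].
  by rewrite !inE /= => /andP[zA /AlA ->]; split=> //; [apply: AlA|apply: Alu (JAu _ xJ)].
have DA : {subset D <= A} by move=> z /DP[].
have qD : (q1 <= #|` D|)%N.
  by rewrite -(leq_pmul2r M1_0) (leq_trans hq1) // (leq_trans hAl) // mulnC.
pose G z := (d * z + 1) / (z + 1).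
have p1 a : a \in A -> 0 < a + 1 by move=> /pA; lra.
have pG z : z \in D -> 0 < G z by move=> /DP[za dza _]; rewrite divr_gt0 ?p1.
have iG z w : z \in D -> w \in D -> z < w -> G z < G w.
  by move=> /DA/pA z0 _; apply: shift_ratio_lt.
have lh z : z \in D -> x + 1 <= (x + 1) * G z <= y + 1.
  move=> /[dup] zD /DP[zA dzA zx]; have z0 := pA _ zA.
  have x1 : 0 < x + 1 by apply: p1.
  apply/andP; split; first by rewrite ler_peMr ?(ltW x1) // ler_pdivlMr ?p1 // mul1r lerD2r ler_peMl // ltW.
  (* Since d x = y, the value G(x) is (y + 1) / (x + 1), and G(z) < G(x) because z < x. *)
  rewrite mulrC -ler_pdivlMr // -ex; apply/ltW/shift_ratio_lt => //.
(* Each G contributes one shifted element above and one below, so the expression has four shifted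
   elements over three. *)
have HGW u v w : u \in D -> v \in D -> w \in D -> (x + 1) * G u * (G w / G v) \in W.
  move=> /DP[uA duA _] /DP[vA dvA _] /DP[wA dwA _].
  have := HW x (d * u) (d * w) v u w (d * v) xA duA dwA vA uA wA dvA.
  congr (_ \in W); rewrite /G; have := p1 _ uA; have := p1 _ vA; have := p1 _ wA.
  have := p1 _ dvA => h1 h2 h3 h4; field.
  by rewrite !gt_eqF.
have [Dl [Du [DlD DuD Dlu [hDl hDu]]]] := fset_halves D.
have hDl' : (q1./2 <= #|` Dl|)%N := leq_trans (half_leq qD) hDl.
have hDu' : (q1./2 <= #|` Du|)%N := leq_trans (half_leq qD) hDu.
have DeA e z : e * z \in D -> d * (e * z) \in A by move=> /DP[].
have count_halves (Z1 Z0 : {fset F}) : {subset Z1 <= D} -> {subset Z0 <= D} ->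
    (q1./2 <= #|` Z1|)%N -> (q1./2 <= #|` Z0|)%N ->
    (forall e u v, 1 < e -> u \in Z1 -> e * u \in Z1 -> v \in Z0 -> e * v \in Z0 ->
       G (e * v) / G v < G (e * u) / G u) ->
    (forall e u v, 1 < e -> u \in D -> e * u \in D -> v \in D -> e * v \in D -> u < v ->
       G (e * v) / G v != G (e * u) / G u) ->
    (k2 * k2 <= count (fun w => (x + 1 < w < y + 1)%R) W)%N.
  move=> Z1D Z0D h1 h0 Hsq Hne.
  have q2 : (0 < q1./2)%N by rewrite half_gt0.
  apply: (@squeeze_count F G (x + 1) _ _ Z1 Z0 W M2) => //.
  - exact: p1.
  - by move=> u /Z1D/DA/pA.
  - by move=> u /Z0D/DA/pA.
  - by move=> u /Z1D/pG.
  - by move=> u /Z0D/pG.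
  - by move=> u v /Z1D uD /Z1D vD; apply: iG.
  - by move=> u v /Z0D uD /Z0D vD; apply: iG.
  - move=> e u v e1 /Z0D uD /Z0D vD /Z0D euD /Z0D evD huv.
    have [uv|vu|//] := ltgtP u v.
      by have := Hne e u v e1 uD euD vD evD uv; rewrite huv eqxx.
    by have := Hne e v u e1 vD evD uD euD vu; rewrite huv eqxx.
  - by move=> u v w /Z1D uD /Z0D vD /Z0D wD; apply: HGW.
  - by move=> u /Z1D uD; apply: lh.
  - exact: leq_trans h0.
  - apply: leq_trans (leq_trans hM2 _); last by rewrite leq_mul2l h0 orbT.
    by rewrite leq_mul2l mulS ?orbT // => z; [move/Z1D|move/Z0D]; apply: DA.
  - exact: leq_trans h1.
  - exact: leq_trans h0.
have pD z : z \in D -> 0 < z by move=> /DA/pA.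
(* Below 1 the ratio G(e z) / G(z) increases in z, so the upper half of [D] has the larger ratios
   and supplies the interval endpoints. Above 1 it decreases and the halves exchange roles. *)
case: sideA => sA.
  have rat e u v : 1 < e -> u \in D -> e * u \in D -> v \in D -> e * v \in D -> u < v ->
      G (e * u) / G u < G (e * v) / G v.
    move=> e1 uD euD vD evD uv.
    by have [+ _] := ratio_monotone d1 e1 (pD _ uD) uv; apply; apply/sA/DeA.
  apply: (count_halves Du Dl) => //.
  - move=> e u v e1 uZ euZ vZ evZ.
    by apply: rat (DlD _ vZ) (DlD _ evZ) (DuD _ uZ) (DuD _ euZ) (Dlu _ _ vZ uZ).
  - by move=> e u v e1 uD euD vD evD uv; rewrite gt_eqF ?rat.
have rat e u v : 1 < e -> u \in D -> e * u \in D -> v \in D -> e * v \in D -> u < v ->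
    G (e * v) / G v < G (e * u) / G u.
  move=> e1 uD euD vD evD uv.
  by have [_ +] := ratio_monotone d1 e1 (pD _ uD) uv; apply; apply/sA/DA.
apply: (count_halves Dl Du) => //.
- move=> e u v e1 uZ euZ vZ evZ.
  by apply: rat (DlD _ uZ) (DlD _ euZ) (DuD _ vZ) (DuD _ evZ) (Dlu _ _ uZ vZ).
- by move=> e u v e1 uD euD vD evD uv; rewrite lt_eqF ?rat.
Qed.

(** * Inequalities of Plünnecke and Ruzsa type *)

(** Petridis's argument: [X'] is a nonempty subset of [X] that minimizes the growth ratio |YS| /
    |Y|, and the bound follows by adding the elements of [C] one at a time. *)
Lemma petridis (F : realFieldType) (X S : {fset F}) :
  0 \notin X -> 0 \notin S -> X != fset0 ->
  exists2 X' : {fset F}, [/\ {subset X' <= X}, X' != fset0 &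
    (#|` mulfs X' S| * #|` X| <= #|` mulfs X S| * #|` X'|)%N] &
  forall C : {fset F}, 0 \notin C ->
    (#|` mulfs (mulfs X' S) C| * #|` X'| <= #|` mulfs X' S| * #|` mulfs X' C|)%N.
Proof.
move=> X0 S0 Xn0.
pose r (Y : {fset F}) : rat := (#|` mulfs Y S|)%:R / (#|` Y|)%:R.
have : exists2 X' : {fset F}, X' \in fpowerset X /\ X' != fset0 &
    forall Y, Y \in fpowerset X -> Y != fset0 -> r X' <= r Y.
  pose P := [seq Y <- enum_fset (fpowerset X) | Y != fset0].
  have XP : X \in P by rewrite mem_filter Xn0 fpowersetE fsubset_refl.
  have [i iP hi] : exists2 Y, Y \in P & forall Z, Z \in P -> r Y <= r Z.
    have : P != [::] by apply: contraTneq XP => ->.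
    elim: {XP} P => [|Y P IH] // _; have [->|Pn] := eqVneq P [::].
      by exists Y; rewrite ?inE // => Z; rewrite inE => /eqP->.
    have [Z ZP hZ] := IH Pn; have [le|lt] := leP (r Y) (r Z).
      exists Y; rewrite ?inE ?eqxx // => V; rewrite inE => /predU1P[-> //|/hZ].
      exact: le_trans.
    exists Z; first by rewrite inE ZP orbT.
    by move=> V; rewrite inE => /predU1P[->|/hZ //]; apply: ltW.
  exists i; first by move: iP; rewrite mem_filter => /andP[].
  by move=> Y YX Yn; apply: hi; rewrite mem_filter Yn.
move=> [X' [/[!fpowersetE] X'X X'n0] hmin].
have minY (Y : {fset F}) : {subset Y <= X'} -> (#|` mulfs X' S| * #|` Y| <= #|` mulfs Y S| * #|` X'|)%N.
  move=> YX; have [->|Yn0] := eqVneq Y fset0; first by rewrite cardfs0 muln0.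
  have {}YX : (Y `<=` X)%fset by apply: fsubset_trans X'X; apply/fsubsetP.
  have := hmin Y; rewrite fpowersetE => /(_ YX Yn0).
  rewrite /r ler_pdivrMr ?ltr0n ?cardfs_gt0 // mulrAC ler_pdivlMr ?ltr0n ?cardfs_gt0 //.
  by rewrite -!natrM ler_nat.
exists X'; first split => //.
- exact/fsubsetP.
- have := hmin X; rewrite fpowersetE fsubset_refl => /(_ isT Xn0).
  rewrite /r ler_pdivrMr ?ltr0n ?cardfs_gt0 // mulrAC ler_pdivlMr ?ltr0n ?cardfs_gt0 //.
  by rewrite -!natrM ler_nat.
elim/fset1U_rect => [|c C cC IH] C0.
  rewrite (_ : mulfs (mulfs X' S) fset0 = fset0) ?cardfs0 //.
  by apply/fsetP => x; rewrite inE; apply/mulfsP => -[a [b []]]; rewrite inE.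
have c0 : c != 0 by apply: contraNneq C0 => <-; rewrite !inE eqxx.
have {}IH : (#|` mulfs (mulfs X' S) C| * #|` X'| <= #|` mulfs X' S| * #|` mulfs X' C|)%N.
  by apply: IH; apply: contra C0; rewrite !inE => ->; rewrite orbT.
(* Adding c loses the dilates of [V], already present in X' C. The dilate of V S is then already
   present in X' S C, and minimality of the ratio of [X'] makes V S large enough to compensate. *)
pose V := [fset x in X' | x * c \in mulfs X' C]%fset.
pose mulc (Y : {fset F}) := [fset x * c | x in Y]%fset.
have card_mulc (Y : {fset F}) : #|` mulc Y| = #|` Y| by apply: card_imfset => x y /(mulIf c0).
have split_c (Y : {fset F}) : mulfs Y (c |` C)%fset = (mulfs Y C `|` mulc Y)%fset.
  apply/fsetP => x; rewrite inE; apply/mulfsP/orP.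
    move=> [a [b [aY + ->]]]; rewrite !inE => /predU1P[->|bC].
      by right; apply/imfsetP; exists a.
    by left; apply/mulfsP; exists a, b.
  move=> [/mulfsP[a [b [aY bC ->]]]|/imfsetP[a /= aY ->]].
    by exists a, b; rewrite !inE bC orbT.
  by exists a, c; rewrite !inE eqxx.
have VX' : {subset V <= X'} by move=> x; rewrite !inE /= => /andP[].
have h1 : (#|` mulfs V S| <= #|` mulfs (mulfs X' S) C `&` mulc (mulfs X' S)|%fset)%N.
  rewrite -card_mulc; apply: card_subset => x /imfsetP[y /= /mulfsP[v [s [vV sS ->]]] ->].
  rewrite inE; apply/andP; split; last first.
    by apply/imfsetP; exists (v * s) => //=; apply/mulfsP; exists v, s; split=> //; apply: VX'.
  move: vV; rewrite !inE /= => /andP[_ /mulfsP[a [b [aX bC e]]]].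
  rewrite mulrAC e mulrAC; apply/mulfsP; exists (a * s), b; split => //.
  by apply/mulfsP; exists a, s.
have h2 : (#|` mulfs X' C `&` mulc X'|%fset <= #|` V|)%N.
  rewrite -(card_mulc V); apply: card_subset => x /fsetIP[xC /imfsetP[v /= vX e]].
  by apply/imfsetP; exists v => //=; rewrite !inE /= vX -e.
rewrite !split_c !cardfsU !card_mulc.
have h3 : (#|` mulfs X' S| * #|` mulfs X' C `&` mulc X'|%fset <=
    #|` mulfs (mulfs X' S) C `&` mulc (mulfs X' S)|%fset * #|` X'|)%N.
  apply: leq_trans (leq_mul (leqnn _) h2) (leq_trans (minY V VX') _).
  by rewrite leq_mul2r h1 orbT.
rewrite mulnBl mulnBr mulnDl mulnDr.
by move: h3 IH; move: (muln _ _) (muln _ _) (muln _ _) (muln _ _) (muln _ _) => *; lia.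
Qed.

(** Fix a representation d = y / z of each quotient. The map sending (d, x) to (x y, x z) is
    injective: the ratio of the image is d, which determines y and hence x. *)
Lemma ruzsa_triangle (F : realFieldType) (X Y Z : {fset F}) :
  0 \notin X -> 0 \notin Y -> 0 \notin Z ->
  (#|` [fset y / z | y in Y, z in Z]%fset| * #|` X| <=
   #|` mulfs X Y| * #|` mulfs X Z|)%N.
Proof.
move=> X0 Y0 Z0.
have nz (T : {fset F}) t : 0 \notin T -> t \in T -> t != 0.
  by move=> T0 tT; apply: contraNneq T0 => <-.
pose D := [fset y / z | y in Y, z in Z]%fset.
pose YZ := [seq (y, z) | y <- enum_fset Y, z <- enum_fset Z].
(* The default value is returned only for d outside [D]. *)
pose f d := head (0, 0) [seq p <- YZ | d == p.1 / p.2].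
have hf d : d \in D -> [/\ (f d).1 \in Y, (f d).2 \in Z & d = (f d).1 / (f d).2].
  move=> /imfset2P[y /= yY [z /= zZ e]].
  have : (y, z) \in [seq p <- YZ | d == p.1 / p.2].
    by rewrite mem_filter e eqxx; apply/allpairsP; exists (y, z).
  have := mem_head (0, 0) [seq p <- YZ | d == p.1 / p.2].
  rewrite /f; case E : [seq p <- YZ | _] => [//|p s] _ _ /=.
  have : p \in [seq p <- YZ | d == p.1 / p.2] by rewrite E mem_head.
  by rewrite mem_filter => /andP[/eqP -> /allpairsP[[? ?] [? ? ->]]].
rewrite -/D.
have cardM (T U : {fset F}) : (#|` T| * #|` U|)%N = size [seq (t, u) | t <- enum_fset T, u <- enum_fset U].
  by rewrite size_allpairs.
rewrite !cardM -(size_map (fun p => (p.2 * (f p.1).1, p.2 * (f p.1).2))).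
apply: uniq_leq_size; last first.
  move=> w /mapP[[d x] /allpairsP[[d' x'] [/= dD xX [-> ->]]] ->] /=.
  have [yY zZ _] := hf _ dD.
  apply/allpairsP; exists (x' * (f d').1, x' * (f d').2); split=> //=.
    by apply/mulfsP; exists x', (f d').1.
  by apply/mulfsP; exists x', (f d').2.
rewrite map_inj_in_uniq.
  by apply: allpairs_uniq; rewrite ?fset_uniq // => -[? ?] [? ?].
have memP d x : (d, x) \in [seq (t, u) | t <- enum_fset D, u <- enum_fset X] -> d \in D /\ x \in X.
  by move=> /allpairsP[[? ?] [/= dD xX [-> ->]]].
move=> [d x] [d' x'] /memP[dD xX] /memP[dD' xX'] /= [e1 e2].
have [yY zZ hd] := hf _ dD; have [yY' zZ' hd'] := hf _ dD'.
have scale (u v w : F) : u != 0 -> w != 0 -> v / w = (u * v) / (u * w).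
  by move=> u0 w0; field; rewrite ?u0 ?w0.
have dd : d = d'.
  rewrite hd hd' (scale x) ?(nz _ _ X0 xX) ?(nz _ _ Z0 zZ) //.
  by rewrite [RHS](scale x') ?(nz _ _ X0 xX') ?(nz _ _ Z0 zZ') // e1 e2.
by move: e1; rewrite -dd => /(mulIf (nz _ _ Y0 yY)) ->.
Qed.

(** Iterating Petridis's bound multiplies the size by at most |XS| / |X| per factor of [S]. The
    triangle inequality then combines four factors with three, which gives the exponent 7. *)
Lemma plunnecke_4_3 (F : realFieldType) (X S : {fset F}) :
  0 \notin X -> 0 \notin S -> X != fset0 ->
  (#|` [fset y / z | y in mulfs (mulfs (mulfs S S) S) S,
                     z in mulfs (mulfs S S) S]%fset| * #|` X| ^ 6 <=
   #|` mulfs X S| ^ 7)%N.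
Proof.
move=> X0 S0 Xn0; set S3 := mulfs (mulfs S S) S.
have no0 (T U : {fset F}) : 0 \notin T -> 0 \notin U -> 0 \notin mulfs T U.
  move=> T0 U0; apply/mulfsP => -[a [b [aT bU /esym/eqP]]].
  by rewrite mulf_eq0 => /orP[] /eqP h; move: T0 U0; rewrite -h ?aT ?bU.
have [Y [YX Yn0 hr] hY] := petridis X0 S0 Xn0.
have Y0 : 0 \notin Y by apply: contra X0; apply: YX.
have S30 : 0 \notin S3 by rewrite !no0.
have y0 : (0 < #|` Y|)%N by rewrite cardfs_gt0.
have x0 : (0 < #|` X|)%N by rewrite cardfs_gt0.
set x := #|` X| in hr x0 *; set a := #|` mulfs X S| in hr *.
have step (C : {fset F}) : 0 \notin C -> (#|` mulfs Y (mulfs S C)| * x <= a * #|` mulfs Y C|)%N.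
  move=> /hY; rewrite mulfsA => h.
  rewrite -(leq_pmul2r y0) -mulnA [(x * _)%N]mulnC mulnA.
  apply: leq_trans (leq_mul h (leqnn x)) _.
  by rewrite mulnAC [(a * _ * _)%N]mulnAC leq_mul2r hr orbT.
have stepn (C : {fset F}) n : 0 \notin C -> (#|` mulfs Y C| * x ^ n <= a ^ n * #|` Y|)%N ->
    (#|` mulfs Y (mulfs S C)| * x ^ n.+1 <= a ^ n.+1 * #|` Y|)%N.
  move=> C0 h; rewrite expnS mulnA (leq_trans (leq_mul (step C C0) (leqnn _))) //.
  by rewrite -mulnA [(a ^ n.+1)%N]expnS -[leqRHS]mulnA leq_mul2l h orbT.
have s1 : (#|` mulfs Y S| * x ^ 1 <= a ^ 1 * #|` Y|)%N by rewrite !expn1.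
have s2 := stepn _ _ S0 s1; have s3 := stepn _ _ (no0 _ _ S0 S0) s2.
rewrite (mulfsA S S S) in s3; have := stepn _ _ S30 s3; rewrite (mulfsC S S3) => s4.
have := ruzsa_triangle Y0 (no0 _ _ S30 S0) S30.
set d := #|` [fset _ | _ in _, _ in _]%fset|; move: s3 s4; set u := #|` mulfs Y S3|; set v := #|` mulfs Y (mulfs S3 S)| => s3 s4 h.
(* The inequality |Y| <= |X| cancels one of the seven factors [x]. *)
suff H : (d * x ^ 7 <= a ^ 7 * #|` Y|)%N.
  rewrite -(leq_pmul2r x0) -mulnA -expnSr (leq_trans H) // leq_mul2l.
  by rewrite card_subset ?orbT.
rewrite -(leq_pmul2r y0).
have -> : (d * x ^ 7 * #|` Y| = (d * #|` Y|) * x ^ 7)%N by ring.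
apply: leq_trans (_ : _ <= (v * x ^ 4) * (u * x ^ 3))%N _.
  have -> : (v * x ^ 4 * (u * x ^ 3) = v * u * x ^ 7)%N by ring.
  by rewrite leq_mul2r h orbT.
apply: leq_trans (leq_mul s4 s3) _.
by apply/eq_leq; ring.
Qed.

(** * Rich lines in a grid *)

(* A line [y = l.1 * x + l.2] is encoded by the pair [l]. *)
Definition line_points (F : realFieldType) (Q : {fset F}) (l : F * F) : {fset F} :=
  [fset x in Q | (l.1 * x + l.2)%R \in Q]%fset.

(** Index of the block containing x when [Q] is cut, in increasing order, into blocks of [w]
    elements; the rank also places points outside [Q]. *)
Definition cell (F : realFieldType) (Q : {fset F}) (w : nat) (x : F) : nat :=
  (#|` [fset q in Q | (q < x)%R]%fset| %/ w)%N.

Lemma cell_le (F : realFieldType) (Q : {fset F}) w x y : x <= y -> (cell Q w x <= cell Q w y)%N.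
Proof.
move=> xy; apply/leq_div2r/card_subset => z; rewrite !inE /= => /andP[-> zx].
exact: lt_le_trans xy.
Qed.

Lemma cell_max (F : realFieldType) (Q : {fset F}) w x : (cell Q w x <= #|` Q| %/ w)%N.
Proof. by apply/leq_div2r/card_subset => z; rewrite !inE /= => /andP[]. Qed.

Lemma card_cell (F : realFieldType) (Q : {fset F}) w k :
  (0 < w)%N -> (#|` [fset x in Q | cell Q w x == k]%fset| <= w)%N.
Proof.
move=> w_gt0; pose rank x := #|` [fset q in Q | (q < x)%R]%fset|.
have rank_lt x y : x \in Q -> x < y -> (rank x < rank y)%N.
  move=> xQ xy; apply: fproper_ltn_card; rewrite fproperE; apply/andP; split.
    by apply/fsubsetP => z; rewrite !inE /= => /andP[-> zx]; apply: lt_trans xy.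
  by apply/negP => /fsubsetP/(_ x); rewrite !inE /= xQ xy ltxx => /(_ isT).
rewrite -[w in (_ <= w)%N](size_iota (k * w)) -(size_map rank).
apply: uniq_leq_size.
  rewrite map_inj_in_uniq ?fset_uniq // => x y; rewrite !inE /= => /andP[xQ _] /andP[yQ _] e.
  by have [/(rank_lt _ _ xQ)|/(rank_lt _ _ yQ)|//] := ltgtP x y; rewrite e ltnn.
move=> r /mapP[x]; rewrite !inE /= => /andP[xQ /eqP ck] ->; rewrite mem_iota.
rewrite -ck /cell -/(rank x) leq_trunc_div /=.
by rewrite {1}(divn_eq (rank x) w) ltn_add2l ltn_mod.
Qed.

Definition cell_pairs (F : realFieldType) (Q : {fset F}) (w : nat) : seq (F * F) :=
  [seq p <- [seq (x, y) | x <- enum_fset Q, y <- enum_fset Q] | cell Q w p.1 == cell Q w p.2].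

Lemma mem_cell_pairs (F : realFieldType) (Q : {fset F}) w x y :
  ((x, y) \in cell_pairs Q w) = [&& x \in Q, y \in Q & cell Q w x == cell Q w y].
Proof.
rewrite mem_filter /= andbC.
have -> : ((x, y) \in [seq (x, y) | x <- enum_fset Q, y <- enum_fset Q]) = (x \in Q) && (y \in Q).
  by apply/allpairsP/andP => [[[a b] [/= ? ? [-> ->]]]|[? ?]]; [|exists (x, y)].
by rewrite andbA.
Qed.

Lemma size_cell_pairs (F : realFieldType) (Q : {fset F}) w :
  (0 < w)%N -> (size (cell_pairs Q w) <= #|` Q| * w)%N.
Proof.
move=> w_gt0; rewrite size_filter /allpairs_dep count_flatten -map_comp sumnE big_map.
apply: leq_trans (_ : _ <= \sum_(x <- enum_fset Q) w)%N _; last first.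
  by rewrite big_const_seq count_predT iter_addn_0 mulnC.
apply: leq_sum => x _ /=; rewrite count_map.
apply: leq_trans (card_cell Q (cell Q w x) w_gt0); rewrite -size_filter.
apply: uniq_leq_size; first by rewrite filter_uniq ?fset_uniq.
by move=> y; rewrite mem_filter !inE /= => /andP[/eqP -> ->]; rewrite eqxx.
Qed.

(** Abscissae of the points of the line that share their grid cell with an earlier point of it. Such
    pairs determine the line, and there are few pairs within cells. *)
Definition repeats (F : realFieldType) (Q : {fset F}) (w : nat) (l : F * F) : {fset F} :=
  [fset x in line_points Q l | has (fun z => [&& (z < x)%R, cell Q w z == cell Q w x &
     cell Q w (l.1 * z + l.2)%R == cell Q w (l.1 * x + l.2)%R]) (enum_fset (line_points Q l))]%fset.

(* An increasing line visits at most [2 * (#|` Q| %/ w) + 1] cells of the grid. *)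
Lemma card_repeats (F : realFieldType) (Q : {fset F}) w l : 0 < l.1 ->
  (#|` line_points Q l| <= #|` repeats Q w l| + (2 * (#|` Q| %/ w) + 1))%N.
Proof.
move=> l0; set X := line_points Q l.
rewrite -leq_subLR.
have RX : {subset repeats Q w l <= X} by move=> x; rewrite !inE /= => /andP[].
have -> : (#|` X| - #|` repeats Q w l| = #|` X `\` repeats Q w l|%fset)%N.
  by rewrite cardfsD (fsetIidPr _) //; apply/fsubsetP.
rewrite addn1 -(size_iota 0 _.+1).
(* Both indices are nondecreasing along the line, so equal sums force equal cells, and the sum takes
   values from 0 to [2 * (#|Q| %/ w)]. *)
pose g x := (cell Q w x + cell Q w (l.1 * x + l.2))%N.
rewrite -(size_map g); apply: uniq_leq_size; last first.
  move=> v /mapP[x _ ->]; rewrite mem_iota add0n ltnS mul2n -addnn leq_add ?cell_max //.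
rewrite map_inj_in_uniq ?fset_uniq //.
have key x y : x \in X -> y \in X -> y \notin repeats Q w l -> x < y -> g x = g y -> False.
  move=> xX yX yR xy gxy; move/negP: yR; apply.
  suff h : has (fun z => [&& (z < y)%R, cell Q w z == cell Q w y &
      cell Q w (l.1 * z + l.2)%R == cell Q w (l.1 * y + l.2)%R]) (enum_fset X).
    by apply/imfsetP; exists y => //=; rewrite inE yX.
  apply/hasP; exists x => //; rewrite xy /=.
  have c1 := cell_le Q w (ltW xy).
  have c2 : (cell Q w (l.1 * x + l.2) <= cell Q w (l.1 * y + l.2))%N.
    by apply: cell_le; rewrite lerD2r ler_pM2l // ltW.
  move: gxy c1 c2; rewrite /g /=.
  move: (cell Q w x) (cell Q w y) (cell Q w _) (cell Q w _) => a b c d.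
  by move=> h1 h2 h3; apply/andP; split; apply/eqP; lia.
move=> x y /fsetDP[xX xR] /fsetDP[yX yR] gxy.
have [xy|yx|//] := ltgtP x y.
  by case: (key x y).
by case: (key y x).
Qed.

(** Double counting of repeats: each line has at least t / 2 of them, and a repeat with its mate is
    one of at most (N w)^2 pairs of points sharing a cell. *)
Lemma rich_lines (F : realFieldType) (Q : {fset F}) (Ls : seq (F * F)) (t : nat) :
  uniq Ls -> (forall l, l \in Ls -> 0 < l.1) ->
  (forall l, l \in Ls -> (t <= #|` line_points Q l|)%N) -> (4 <= t)%N ->
  (size Ls * t ^ 3 <= 162 * #|` Q| ^ 4)%N.
Proof.
move=> uLs pos rich t4; set N := #|` Q|.
case: Ls uLs pos rich => [|l0 Ls'] //; set Ls := l0 :: Ls' => uLs pos rich.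
have tN : (t <= N)%N.
  apply: leq_trans (rich l0 (mem_head _ _)) _.
  by apply: card_subset => x; rewrite !inE /= => /andP[].
(* Cells are just wide enough for a line to visit at most about t / 4 of them. *)
pose w := (8 * N %/ t + 1)%N; have w0 : (0 < w)%N by rewrite /w addn1.
pose first_mate (p : (F * F) * F) : F := head 0
  [seq z <- enum_fset (line_points Q p.1) | [&& z < p.2, cell Q w z == cell Q w p.2 &
     cell Q w (p.1.1 * z + p.1.2) == cell Q w (p.1.1 * p.2 + p.1.2)]].
have mateP l x : x \in repeats Q w l -> [/\ x \in line_points Q l,
    first_mate (l, x) \in line_points Q l, first_mate (l, x) < x,
    cell Q w (first_mate (l, x)) = cell Q w x &
    cell Q w (l.1 * first_mate (l, x) + l.2) = cell Q w (l.1 * x + l.2)].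
  move=> /imfsetP[x' /=]; rewrite inE => /andP[xl hx] e; rewrite -{}e in xl hx.
  rewrite /first_mate /=; case E : seq.filter => [|z s] /=.
    by move: hx; rewrite has_filter E.
  have : z \in z :: s by rewrite mem_head.
  by rewrite -E mem_filter => /andP[/and3P[zx /eqP -> /eqP ->] zl].
pose T := [seq (l, x) | l <- Ls, x <- enum_fset (repeats Q w l)].
have memT l x : (l, x) \in T -> l \in Ls /\ x \in repeats Q w l.
  by move=> /allpairsPdep[? [? [? ? [-> ->]]]].
have szT : (size Ls * (t - (2 * (N %/ w) + 1)) <= size T)%N.
  rewrite size_allpairs_dep sumnE big_map -sum1_size big_distrl /= !big_seq.
  apply: leq_sum => l lLs; rewrite mul1n leq_subLR addnC.
  exact: leq_trans (rich l lLs) (card_repeats Q w (pos l lLs)).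
pose img (p : (F * F) * F) := ((first_mate p, p.2),
  (p.1.1 * first_mate p + p.1.2, p.1.1 * p.2 + p.1.2)).
have szTw : (size T <= (N * w) ^ 2)%N.
  pose C := cell_pairs Q w.
  apply: leq_trans (_ : _ <= size [seq (p, q) | p <- C, q <- C])%N _; last first.
    by rewrite size_allpairs mulnn leq_exp2r // size_cell_pairs.
  rewrite -(size_map img); apply: uniq_leq_size; last first.
    move=> _ /mapP[[l x] /memT[lLs /mateP[xl zl zx c1 c2]] ->].
    apply/allpairsP; exists (img (l, x)); split=> //; rewrite /img /= mem_cell_pairs.
      by move: xl zl; rewrite !inE /= c1 eqxx => /andP[-> _] /andP[-> _].
    by move: xl zl; rewrite !inE /= c2 eqxx => /andP[_ ->] /andP[_ ->].
  rewrite map_inj_in_uniq.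
    by apply: allpairs_uniq_dep => // -[? ?] [? ?] _ _ /= [-> ->].
  move=> [l x] [l' x'] /memT[_ /mateP[_ _ zx _ _]] /memT[_ /mateP[_ _ _ _ _]].
  rewrite /img /= => -[ez ex]; rewrite -{}ez -{}ex {x'}; move: (first_mate _) zx => z zx e1 e2.
  congr (_, _); case: l l' e1 e2 => [u v] [u' v'] /= e1 e2.
  (* Two points with distinct abscissae determine the slope and the intercept. *)
  have : (u - u') * (x - z) = 0 by lra.
  move/eqP; rewrite mulf_eq0 (subr_eq0 x) (gt_eqF zx) orbF subr_eq0 => /eqP uu.
  by move: e1; rewrite uu => /addrI ->.
move: szT szTw; set s := size Ls; set m := size T => h1 h2.
have Nw : (8 * (N %/ w) <= t)%N.
  have h : (8 * N < w * t)%N by rewrite /w addn1 ltn_ceil //; lia.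
  rewrite -(leq_pmul2r w0) -mulnA.
  by apply: leq_trans (leq_mul (leqnn 8) (leq_trunc_div N w)) _; rewrite (mulnC t) ltnW.
have wt : (w * t <= 9 * N)%N.
  by rewrite /w mulnDl mul1n; have := leq_trunc_div (8 * N) t; lia.
(* From 8 (N / w) <= t and 4 <= t, the number of visited cells is at most t / 4 + 1 <= t / 2. *)
have h3 : (s * t <= 2 * (N * w) ^ 2)%N.
  apply: leq_trans (_ : _ <= 2 * (s * (t - (2 * (N %/ w) + 1))))%N _.
    by rewrite mulnCA leq_mul2l; apply/orP; right; lia.
  by rewrite leq_mul2l (leq_trans h1).
have -> : (s * t ^ 3 = s * t * t ^ 2)%N by ring.
apply: leq_trans (leq_mul h3 (leqnn _)) _.
have -> : (2 * (N * w) ^ 2 * t ^ 2 = 2 * N ^ 2 * (w * t) ^ 2)%N by ring.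
have -> : (162 * N ^ 4 = 2 * N ^ 2 * (9 * N) ^ 2)%N by ring.
by rewrite leq_mul2l leq_exp2r // wt orbT.
Qed.

(** * Collinear triples and multiplicative energy *)

Lemma sqr_sum_le (I : Type) (r : seq I) (c : I -> nat) :
  ((\sum_(i <- r) c i) ^ 2 <= size r * \sum_(i <- r) c i ^ 2)%N.
Proof.
rewrite -(leq_pmul2l (ltn0Sn 1)) -mulnn big_distrlr /= big_distrr /=.
apply: leq_trans (_ : _ <= \sum_(i <- r) \sum_(j <- r) (c i ^ 2 + c j ^ 2))%N _.
  by apply: leq_sum => i _; rewrite big_distrr /=; apply: leq_sum => j _; exact: nat_Cauchy.
under eq_bigr do rewrite big_split /= big_const_seq count_predT iter_addn_0.
by rewrite big_split /= big_const_seq count_predT iter_addn_0 -big_distrl /=; apply/eq_leq; ring.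
Qed.

(** Cauchy-Schwarz for the fibre sizes of [f]: they sum to [size s], and their squares sum to the
    number of colliding pairs. *)
Lemma card_collisions (T K : eqType) (s : seq T) (f : T -> K) (P : seq K) :
  uniq P -> (forall u, u \in s -> f u \in P) ->
  (size s ^ 2 <= size P * size [seq p <- [seq (u, v) | u <- s, v <- s] | f p.1 == f p.2])%N.
Proof.
move=> uP sP; pose c p := count (fun v => p == f v) s.
have pick u (g : K -> nat) : u \in s -> (\sum_(p <- P) (p == f u) * g p = g (f u))%N.
  move=> us; rewrite (bigD1_seq (f u)) ?sP //= eqxx mul1n big1 ?addn0 // => p.
  by move=> /negPf ->.
have -> : size s = (\sum_(p <- P) c p)%N.
  under eq_bigr do rewrite /c -sum1_count big_mkcond /=.
  rewrite exchange_big /= -sum1_size !big_seq; apply: eq_bigr => u us.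
  rewrite -[LHS](pick u (fun=> 1%N) us).
  by apply: eq_bigr => p _; rewrite muln1; case: eqP.
have -> : size [seq p <- [seq (u, v) | u <- s, v <- s] | f p.1 == f p.2] =
    (\sum_(p <- P) c p ^ 2)%N.
  rewrite size_filter /allpairs_dep count_flatten -map_comp sumnE big_map.
  transitivity (\sum_(u <- s) c (f u))%N.
    by apply: eq_bigr => u _ /=; rewrite count_map.
  transitivity (\sum_(u <- s) \sum_(p <- P) (p == f u) * c p)%N.
    by rewrite !big_seq; apply: eq_bigr => u us; rewrite pick.
  rewrite exchange_big /=; apply: eq_bigr => p _.
  rewrite -big_distrl /= -mulnn; congr (_ * _)%N.
  by rewrite /c -sum1_count [RHS]big_mkcond; apply: eq_bigr => u _; case: eqP.
exact: sqr_sum_le.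
Qed.

(** Layer-cake summation: the increments of n^3 are at most 3 (t + 1)^2, and at most 162 N^4 / (t +
    1)^3 lines have more than t points. The harmonic sum remains. *)
Lemma sum_cubes_le (F : realFieldType) (Q : {fset F}) (Ls : seq (F * F)) :
  uniq Ls -> (forall l, l \in Ls -> 0 < l.1) -> (size Ls <= #|` Q| ^ 4)%N ->
  (\sum_(l <- Ls) #|` line_points Q l| ^ 3)%N%:R <=
    486 * #|` Q|%:R ^+ 4 * \sum_(t < #|` Q|) (t.+1%:R)^-1 :> F.
Proof.
move=> uLs pos szL; set N := #|` Q|.
have cube n : (n ^ 3 <= \sum_(t < n) 3 * t.+1 ^ 2)%N.
  elim: n => [|n IH]; first by rewrite big_ord0.
  rewrite big_ord_recr /=; apply: leq_trans (leq_add IH (leqnn _)).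
  by rewrite !expnS !expn0; nia.
pose c t := count (fun l => (t < #|` line_points Q l|)%N) Ls.
have cubes : (\sum_(l <- Ls) #|` line_points Q l| ^ 3 <= \sum_(t < N) 3 * t.+1 ^ 2 * c t)%N.
  apply: leq_trans (_ : _ <= \sum_(l <- Ls) \sum_(t < N)
      3 * t.+1 ^ 2 * (t < #|` line_points Q l|))%N _.
    apply: leq_sum => l _; apply: leq_trans (cube _) _.
    have lN : (#|` line_points Q l| <= N)%N by apply: card_subset => x; rewrite !inE /= => /andP[].
    rewrite (big_ord_widen N (fun t => 3 * t.+1 ^ 2)%N lN) big_mkcond /=.
    by apply: leq_sum => t _; case: ltnP => _; rewrite ?muln1.
  rewrite exchange_big /=; apply: leq_sum => t _; rewrite -big_distrr /= leq_mul2l.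
  by rewrite /c -sum1_count [leqRHS]big_mkcond /=; apply: leq_sum => l _; case: (t < _)%N.
have ct t : (c t * t.+1 ^ 3 <= 162 * N ^ 4)%N.
  have [t4|t4] := leqP 4 t.+1.
    rewrite /c -size_filter; apply: rich_lines => //.
    - exact: filter_uniq.
    - by move=> l; rewrite mem_filter => /andP[_ /pos].
    - by move=> l; rewrite mem_filter => /andP[].
  (* For t + 1 < 4 the trivial bound on the number of lines suffices, as 3^3 <= 162. *)
  have c1 : (c t <= N ^ 4)%N by apply: leq_trans szL; apply: count_size.
  rewrite mulnC; apply: leq_mul => //; apply: (@leq_trans (3 ^ 3)) => //.
  by rewrite leq_exp2r.
have : (\sum_(l <- Ls) #|` line_points Q l| ^ 3)%N%:R <= (\sum_(t < N) 3 * t.+1 ^ 2 * c t)%N%:R :> F.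
  by rewrite ler_nat.
move=> /le_trans; apply; rewrite natr_sum mulr_sumr; apply: ler_sum => t _.
rewrite ler_pdivlMr ?ltr0n // -natrM.
have -> : 486 * N%:R ^+ 4 = (486 * N ^ 4)%N%:R :> F by rewrite natrM natrX.
by rewrite ler_nat; move: (ct t); rewrite !expnS; nia.
Qed.

(** Cauchy-Schwarz bounds the number of solutions of (a + 1)(b + 1) = (c + 1)(d + 1) from below. The
    scaled collinear triples they give in the grid Q x Q bound it from above by the sum of cubes. *)
Lemma shifted_energy (F : realFieldType) (A : {fset F}) :
  (forall a, a \in A -> 0 < a) ->
  (#|` A|%:R ^+ 6 <= #|` mulfs (shiftfs A) (shiftfs A)|%:R *
    (7776 * #|` mulfs A A|%:R ^+ 4 * \sum_(t < 2 * #|` mulfs A A|) (t.+1%:R)^-1) :> F).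
Proof.
move=> pA; set n := #|` A|; set L := #|` mulfs A A|; set P := mulfs _ _.
have [A0|An0] := eqVneq A fset0.
  rewrite /n A0 cardfs0 expr0n /= !mulr_ge0 ?ler0n ?exprn_ge0 //.
  by apply: sumr_ge0 => i _; rewrite invr_ge0 ler0n.
pose AA := [seq (a, b) | a <- enum_fset A, b <- enum_fset A].
have memAA a b : ((a, b) \in AA) = (a \in A) && (b \in A).
  by apply/allpairsP/andP => [[[? ?] [/= ? ? [-> ->]]]|[? ?]]; [|exists (a, b)].
have uAA : uniq AA by apply: allpairs_uniq; rewrite ?fset_uniq // => -[? ?] [? ?].
have szAA : size AA = (n ^ 2)%N by rewrite size_allpairs mulnn.
pose f (p : F * F) := (p.1 + 1) * (p.2 + 1).
pose quads := [seq p <- [seq (u, v) | u <- AA, v <- AA] | f p.1 == f p.2].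
have collisions : (n ^ 4 <= #|` P| * size quads)%N.
  have -> : (n ^ 4 = size AA ^ 2)%N by rewrite szAA -expnM.
  apply: card_collisions; first exact: fset_uniq.
  move=> [a b]; rewrite memAA => /andP[aA bA]; apply/mulfsP; exists (a + 1), (b + 1).
  by split=> //; apply/imfsetP; [exists a|exists b].
pose Q := (mulfs A A `|` [fset (- a)%R | a in A])%fset.
(* The line through [(- h, - h')] and [(h * a, h' * c)], where [p = (a, c)], [q = (h, h')] *)
pose line (p q : F * F) : F * F :=
  let u := q.2 * (p.2 + 1) / (q.1 * (p.1 + 1)) in (u, u * q.1 - q.2).
have lineP a b c d h h' : a \in A -> b \in A -> c \in A -> d \in A -> h \in A -> h' \in A ->
   f (a, b) = f (c, d) ->
   [/\ (line (a, c) (h, h')).1 * (h * a) + (line (a, c) (h, h')).2 = h' * c,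
       (line (a, c) (h, h')).1 * (h * d) + (line (a, c) (h, h')).2 = h' * b &
       (line (a, c) (h, h')).1 * (- h) + (line (a, c) (h, h')).2 = - h'].
  move=> /pA a0 /pA b0 /pA c0 /pA d0 /pA h0 /pA h'0; rewrite /f /line /= => e.
  have ha : a + 1 != 0 by rewrite gt_eqF // addr_gt0.
  have hn0 : h != 0 by rewrite gt_eqF.
  split.
  - by field; rewrite ?ha ?hn0.
  - have -> : b = (c + 1) * (d + 1) / (a + 1) - 1.
      by rewrite -e; field; rewrite ?ha.
    by field; rewrite ?ha ?hn0.
  - by field; rewrite ?ha ?hn0.
pose Ls := undup [seq line p q | p <- AA, q <- AA].
have pos l : l \in Ls -> 0 < l.1.
  rewrite mem_undup => /allpairsP[[[a c] [h h']] [/=]].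
  rewrite !memAA => /andP[/pA a0 /pA c0] /andP[/pA h0 /pA h'0] ->.
  by rewrite /line /= divr_gt0 // mulr_gt0 // addr_gt0.
pose cube l := [seq (x, yz) | x <- enum_fset (line_points Q l),
   yz <- [seq (y, z) | y <- enum_fset (line_points Q l), z <- enum_fset (line_points Q l)]].
pose S := [seq (p, h) | p <- quads, h <- AA].
pose T := [seq (l, x) | l <- Ls, x <- cube l].
have szST : (size S <= size T)%N.
  (* The three abscissae recover h, a and d; evaluating the line at them recovers h', c and b. Hence
     the map is injective. *)
  pose img (p : ((F * F) * (F * F)) * (F * F)) :=
    let: (((a, b), (c, d)), (h, h')) := p in
    (line (a, c) (h, h'), (h * a, (h * d, - h))).
  have memS a b c d h h' : (((a, b), (c, d)), (h, h')) \in S -> 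
    [/\ [/\ a \in A, b \in A, c \in A & d \in A], h \in A, h' \in A & f (a, b) = f (c, d)].
    move=> /allpairsP[[[[? ?] [? ?]] [? ?]] [/=]].
    rewrite mem_filter => /andP[/eqP e /allpairsP[[[? ?] [? ?]] [/=]]].
    move=> i1 i2 e3 i3 [-> -> -> -> -> ->]; case: e3 e i1 i2 i3 => -> -> -> -> e.
    by rewrite !memAA => /andP[-> ->] /andP[-> ->] /andP[-> ->].
  rewrite -(size_map img); apply: uniq_leq_size; last first.
    move=> _ /mapP[[[[a b] [c d]] [h h']] /memS[[aA bA cA dA] hA h'A e] ->].
    have [l1 l2 l3] := lineP _ _ _ _ _ _ aA bA cA dA hA h'A e.
    apply/allpairsPdep; exists (line (a, c) (h, h')), (h * a, (h * d, - h)); split=> //.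
      by rewrite mem_undup; apply/allpairsP; exists ((a, c), (h, h')); rewrite !memAA aA cA hA h'A.
    have inQ x y : x \in A -> y \in A -> x * y \in Q.
      by move=> xA yA; apply/fsetUP; left; apply/mulfsP; exists x, y.
    have inQN x : x \in A -> - x \in Q.
      by move=> xA; apply/fsetUP; right; apply/imfsetP; exists x.
    have inl x : x \in Q -> (line (a, c) (h, h')).1 * x + (line (a, c) (h, h')).2 \in Q ->
        x \in line_points Q (line (a, c) (h, h')).
      by move=> xQ lQ; apply/imfsetP; exists x => //=; rewrite inE xQ.
    apply/allpairsP; exists (h * a, (h * d, - h)); split=> //=.
      by apply: inl; [apply: inQ|rewrite l1; apply: inQ].
    apply/allpairsP; exists (h * d, - h); split=> //=; apply: inl.
    - exact: inQ.
    - by rewrite l2; apply: inQ.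
    - exact: inQN.
    - by rewrite l3; apply: inQN.
  rewrite map_inj_in_uniq.
    apply: allpairs_uniq => //; last by move=> [? ?] [? ?].
    by rewrite filter_uniq //; apply: allpairs_uniq => // -[? ?] [? ?].
  move=> [[[a b] [c d]] [h h']] [[[a' b'] [c' d']] [k k']].
  move=> /memS[[aA bA cA dA] hA h'A e] /memS[[aA' bA' cA' dA'] kA k'A e'].
  have [l1 l2 l3] := lineP _ _ _ _ _ _ aA bA cA dA hA h'A e.
  have [m1 m2 m3] := lineP _ _ _ _ _ _ aA' bA' cA' dA' kA k'A e'.
  have nz x : x \in A -> x != 0 by move=> /pA; rewrite lt0r => /andP[].
  rewrite /img => E; have El := congr1 fst E; have ea := congr1 (fun p => p.2.1) E.
  have ed := congr1 (fun p => p.2.2.1) E; have /oppr_inj hk := congr1 (fun p => p.2.2.2) E.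
  rewrite /= in El ea ed hk; rewrite -El in m1 m2 m3; rewrite -hk in ea ed m1 m2 m3 *.
  have aa : a = a' by apply: mulfI (nz _ hA) _ _ ea.
  have dd : d = d' by apply: mulfI (nz _ hA) _ _ ed.
  have kk : h' = k' by apply: oppr_inj; rewrite -l3 -m3.
  rewrite -aa -dd -kk in m1 m2 *.
  have -> : c' = c by apply: (mulfI (nz _ h'A)); rewrite -l1 -m1.
  have -> // : b' = b by apply: (mulfI (nz _ h'A)); rewrite -l2 -m2.
have szS : size S = (size quads * n ^ 2)%N by rewrite size_allpairs szAA.
have szT : size T = (\sum_(l <- Ls) #|` line_points Q l| ^ 3)%N.
  rewrite size_allpairs_dep sumnE big_map; apply: eq_bigr => l _.
  by rewrite !size_allpairs !expnS expn0 muln1.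
have L1 : (n <= L)%N.
  by have /fset0Pn[a aA] := An0; apply: card_mulfs_ge (aA); rewrite gt_eqF //; apply: pA.
(* The factor 2 enters to the fourth power: 7776 = 486 * 2^4. *)
have QL : (#|` Q| <= 2 * L)%N.
  apply: leq_trans (leq_card_fsetU _ _).1 _; rewrite mul2n -addnn leq_add //.
  by apply: leq_trans (leq_imfset_card _ _ _) _.
have szL : (size Ls <= #|` Q| ^ 4)%N.
  apply: leq_trans (size_undup _) _; rewrite size_allpairs szAA -expnD leq_exp2r //.
  apply: leq_trans (_ : _ <= #|` mulfs A A|)%N _; first exact: L1.
  by apply/fsubset_leq_card/fsubsetUl.
have := sum_cubes_le (undup_uniq _) pos szL; rewrite -szT => hT.
have h6 : (n ^ 6 <= #|` P| * size T)%N.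
  have -> : (n ^ 6 = n ^ 4 * n ^ 2)%N by rewrite -expnD.
  apply: leq_trans (leq_mul collisions (leqnn _)) _.
  by rewrite -mulnA -szS leq_mul2l szST orbT.
have {}h6 : n%:R ^+ 6 <= #|` P|%:R * (size T)%:R :> F by rewrite -natrX -natrM ler_nat.
apply: le_trans h6 _; rewrite ler_wpM2l ?ler0n //; apply: le_trans hT _.
have inv0 m : 0 <= \sum_(t < m) (t.+1%:R)^-1 :> F.
  by apply: sumr_ge0 => t _; rewrite invr_ge0 ler0n.
have c0 : 0 <= 486 * #|` Q|%:R ^+ 4 :> F by rewrite mulr_ge0 ?exprn_ge0 ?ler0n.
apply: (ler_pM c0 (inv0 _)).
  have -> : 7776 * L%:R ^+ 4 = 486 * (2 * L)%:R ^+ 4 :> F by rewrite natrM; ring.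
  by rewrite ler_wpM2l ?ler0n // lerXn2r ?nnegrE ?ler0n // ler_nat.
rewrite (big_ord_widen _ (fun t => (t.+1%:R)^-1) QL) big_mkcond /=.
by apply: ler_sum => t _; case: ifP => // _; rewrite invr_ge0 ler0n.
Qed.

(** * Many quotients of four shifted factors by three *)

Definition quot43 (F : realFieldType) (S : {fset F}) : {fset F} :=
  [fset y / z | y in mulfs (mulfs (mulfs S S) S) S, z in mulfs (mulfs S S) S]%fset.

(** Secures, at the cost of a factor 2, the one-sidedness with respect to 1 that
    [shifted_products_count] requires. *)
Lemma one_sided_half (F : realFieldType) (A : {fset F}) :
  exists A' : {fset F}, [/\ {subset A' <= A}, (#|` A| <= 2 * #|` A'|)%N &
    (forall a, a \in A' -> a <= 1) \/ (forall a, a \in A' -> 1 <= a)].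
Proof.
pose Al := [fset a in A | a <= 1]%fset; pose Au := [fset a in A | 1 <= a]%fset.
have AlA : {subset Al <= A} by move=> x; rewrite !inE /= => /andP[].
have AuA : {subset Au <= A} by move=> x; rewrite !inE /= => /andP[].
have cA : (#|` A| <= #|` Al| + #|` Au|)%N.
  apply: leq_trans (leq_card_fsetU Al Au).1; apply: card_subset => x xA.
  by rewrite !inE /= xA /=; apply: le_total.
have [h|h] := leqP #|` Al| #|` Au|.
  exists Au; split=> //; first by lia.
  by right=> a; rewrite !inE /= => /andP[].
exists Al; split=> //; first by lia.
by left=> a; rewrite !inE /= => /andP[].
Qed.

(** Provides a block length [M] long enough for a popular ratio and the number [k] of such blocks
    that fit into [h] elements. *)
Lemma quotient_parameters (F : realFieldType) (L h : nat) (C : F) :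
  (0 < h)%N -> 2 * L%:R <= C * h%:R -> exists M k : nat,
  [/\ (0 < M)%N, (2 * L <= M * h)%N, (k * M <= h)%N, M%:R <= C + 1 &
   h%:R <= (k%:R + 1) * (C + 1)].
Proof.
move=> h0 hL; exists (2 * L %/ h).+1, (h %/ (2 * L %/ h).+1)%N.
have hM : (2 * L %/ h).+1%:R <= C + 1.
  rewrite -natr1 lerD2r -(ler_pM2r (_ : 0 < h%:R)) ?ltr0n // (le_trans _ hL) //.
  by rewrite -!natrM ler_nat leq_trunc_div.
split=> //; first by rewrite ltnW // ltn_ceil.
  exact: leq_trunc_div.
apply: le_trans (_ : _ <= ((h %/ (2 * L %/ h).+1)%:R + 1) * (2 * L %/ h).+1%:R) _.
  by rewrite natr1 -natrM ler_nat ltnW // ltn_ceil.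
by rewrite ler_wpM2l // addr_ge0 ?ler0n.
Qed.

Lemma leq_double_half k : (k <= 2 * k./2 + 1)%N.
Proof. by lia. Qed.

(** Block parameters for the two squeezes: first in a half of size about n / 4, with C = 10 K, then
    in a half of size [k1./2], with C = 256 K^2. The lower bound on n absorbs the rounding losses
    and leaves k1 of order n / K and k2 of order n / K^3. *)
Lemma parameters (F : realFieldType) (K : F) (n m L : nat) :
  1 <= K -> L%:R <= K * n%:R -> (n <= 2 * m)%N -> 256 * 260 * K ^+ 3 <= n%:R ->
  exists M1 k1 M2 k2 : nat,
  [/\ [/\ (0 < M1)%N, (0 < M2)%N & (1 < k1)%N],
      (2 * L <= M1 * m./2)%N /\ (2 * L <= M2 * k1./2)%N,
      (k1 * M1 <= m./2)%N /\ (k2 * M2 <= k1./2)%N &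
      n%:R ^+ 3 <= 60 * (256 * 260) ^+ 2 * K ^+ 7 * (k1 * (k2 * k2))%:R].
Proof.
move=> K1 LK nm hn; have K0 : 0 < K by lra.
have K2 : 1 <= K ^+ 2 by rewrite exprn_ege1.
have KK : K <= K ^+ 3 by rewrite exprS ler_peMr // ltW.
have n10 : (10 <= n)%N by rewrite -(ler_nat F); lra.
have := leq_double_half m; move: (m./2) => h mh.
have h5n : (n <= 5 * h)%N by move: n10 nm mh; clear; lia.
have h5 : n%:R <= 5 * h%:R :> F by rewrite -natrM ler_nat.
have h0 : (0 < h)%N by move: n10 h5n; clear; lia.
have [|M1 [k1 [M1_0 hM1 hk1 _ hk1']]] := @quotient_parameters F L h (10 * K) h0.
  by have := ler_wpM2l (ltW K0) h5; lra.
have k1K : n%:R <= 60 * K * k1%:R.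
  by have := ler0n F k1; nra.
have h2K : n%:R <= 128 * K * (k1./2)%:R.
  have : k1%:R <= 2 * (k1./2)%:R + 1 :> F by rewrite -natrM -(natrD _ _ 1) ler_nat leq_double_half.
  by rewrite -(ler_pM2l K0); lra.
have q1 : (1 < k1)%N by rewrite -(ltr_nat F) -(ltr_pM2l K0); lra.
have h20 : (0 < k1./2)%N by rewrite half_gt0.
exists M1, k1; move: (k1./2) h20 h2K => h2 h20 h2K.
have [|M2 [k2 [M2_0 hM2 hk2 _ hk2']]] := @quotient_parameters F L h2 (256 * K ^+ 2) h20.
  by have := ler_wpM2l (ltW K0) h2K; lra.
have k2K : n%:R <= 256 * 260 * K ^+ 3 * k2%:R.
  have a : h2%:R <= (k2%:R + 1) * (260 * K ^+ 2).
    by apply: le_trans hk2' _; rewrite ler_wpM2l ?addr_ge0 ?ler0n //; lra.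
  by have := ler_wpM2l (ltW K0) a; lra.
exists M2, k2; split=> //.
have n0 : 0 <= n%:R :> F by rewrite ler0n.
have -> : n%:R ^+ 3 = n%:R * (n%:R * n%:R) :> F by ring.
apply: (@le_trans _ _ ((60 * K * k1%:R) * ((256 * 260 * K ^+ 3 * k2%:R) * (256 * 260 * K ^+ 3 * k2%:R)))).
  by rewrite !ler_pM ?mulr_ge0.
by rewrite !natrM le_eqVlt; apply/orP; left; apply/eqP; ring.
Qed.

Lemma many_quotients (F : realFieldType) (A : {fset F}) (K : F) :
  (forall a, a \in A -> 0 < a) -> 1 <= K ->
  #|` mulfs A A|%:R <= K * #|` A|%:R -> 256 * 260 * K ^+ 3 <= #|` A|%:R ->
  #|` A|%:R ^+ 3 <= 60 * (256 * 260) ^+ 2 * K ^+ 7 * #|` quot43 (shiftfs A)|%:R :> F.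
Proof.
move=> pA K1 hK hn; have [A' [A'A hA' side]] := one_sided_half A.
have LK : #|` mulfs A' A'|%:R <= K * #|` A|%:R :> F.
  by apply: le_trans hK; rewrite ler_nat; apply/card_subset/mulfs_sub.
have [M1 [k1 [M2 [k2 [[M1_0 M2_0 k1_1] [hM1 hM2] [hk1 hk2] bound]]]]] := parameters K1 LK hA' hn.
apply: le_trans bound _; apply: ler_wpM2l.
  by rewrite !mulr_ge0 ?exprn_ge0 ?ler0n // (le_trans ler01).
rewrite ler_nat.
(* Here [k1] is both the number of outer blocks and the guaranteed number of z for each popular
   ratio. *)
apply: (@shifted_products_count _ A' _ M1 k1 k1 M2 k2) => //.
  by move=> a /A'A/pA.
move=> a1 a2 a3 a4 b1 b2 b3 i1 i2 i3 i4 j1 j2 j3.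
have sh a : a \in A' -> a + 1 \in shiftfs A by move=> /A'A aA; apply/imfsetP; exists a.
apply/imfset2P; exists ((a1 + 1) * (a2 + 1) * (a3 + 1) * (a4 + 1)).
  by rewrite /= !mem_mulfs ?sh.
by exists ((b1 + 1) * (b2 + 1) * (b3 + 1)); rewrite //= !mem_mulfs ?sh.
Qed.

(** * Combination of the bounds *)

(* The factor [H] is logarithmic in [L]; any bound [H ^+ 12 <= c3 * L] with an exponent
   above 6 suffices, since [n ^+ 15 <= T ^+ 7 * H ^+ 6] up to powers of [K]. *)
Lemma combine_exponents (F : realFieldType) (n L K P W T H c1 c2 c3 : F) :
  0 < n -> 0 <= L -> 0 <= K -> 0 <= P -> 0 <= W -> 0 <= H ->
  0 <= c1 -> 0 <= c2 -> 0 <= c3 ->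
  L <= K * n -> W * P ^+ 6 <= T ^+ 7 -> n ^+ 6 <= P * (c2 * L ^+ 4 * H) ->
  H ^+ 12 <= c3 * L -> n ^+ 3 <= c1 * K ^+ 7 * W ->
  n ^+ 29 <= c1 ^+ 2 * c2 ^+ 12 * c3 * K ^+ 63 * T ^+ 14.
Proof.
move=> n0 L0 K0 P0 W0 H0 c10 c20 c30 LK WP nP HL nW.
have ge0 := (mulr_ge0, exprn_ge0, ltW n0).
(* The twelfth power of the energy bound turns H^12 into one more factor L; replacing L^49 by (K
   n)^49 leaves n to the power 72 - 49 = 23. *)
have hP : n ^+ 23 <= c2 ^+ 12 * c3 * K ^+ 49 * P ^+ 12.
  rewrite -(ler_pM2r (exprn_gt0 49 n0)) -exprD.
  have -> : n ^+ (23 + 49) = (n ^+ 6) ^+ 12 by rewrite -exprM.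
  apply: (le_trans (lerXn2r 12 _ _ nP)); rewrite ?nnegrE ?ge0 //.
  apply: (@le_trans _ _ (P ^+ 12 * c2 ^+ 12 * L ^+ 48 * (c3 * L))).
    have -> : (P * (c2 * L ^+ 4 * H)) ^+ 12 = P ^+ 12 * c2 ^+ 12 * L ^+ 48 * H ^+ 12.
      by rewrite 3!exprMn -exprM; move: (P ^+ 12) (c2 ^+ 12) (H ^+ 12) (L ^+ _) => *; ring.
    by rewrite ler_wpM2l ?ge0.
  have -> : P ^+ 12 * c2 ^+ 12 * L ^+ 48 * (c3 * L) = P ^+ 12 * c2 ^+ 12 * c3 * L ^+ 49.
    by rewrite (exprSr L 48); ring.
  have -> : c2 ^+ 12 * c3 * K ^+ 49 * P ^+ 12 * n ^+ 49 = P ^+ 12 * c2 ^+ 12 * c3 * (K * n) ^+ 49.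
    by rewrite exprMn; move: (K ^+ 49) (n ^+ 49) => *; ring.
  by rewrite ler_wpM2l ?ge0 // lerXn2r ?nnegrE ?ge0.
have hT : (W * P ^+ 6) ^+ 2 <= T ^+ 14.
  have -> : T ^+ 14 = (T ^+ 7) ^+ 2 by rewrite -exprM.
  have WP0 : 0 <= W * P ^+ 6 by rewrite ?ge0.
  by apply: lerXn2r => //; rewrite nnegrE // (le_trans WP0).
have hn : n ^+ 6 <= (c1 * K ^+ 7 * W) ^+ 2.
  have -> : n ^+ 6 = (n ^+ 3) ^+ 2 by rewrite -exprM.
  by rewrite lerXn2r ?nnegrE ?ge0.
have -> : n ^+ 29 = n ^+ 6 * n ^+ 23 by rewrite -exprD.
apply: le_trans (ler_pM _ _ hn hP) _; rewrite ?ge0 //.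
have -> : (c1 * K ^+ 7 * W) ^+ 2 * (c2 ^+ 12 * c3 * K ^+ 49 * P ^+ 12) =
    c1 ^+ 2 * c2 ^+ 12 * c3 * K ^+ 63 * (W * P ^+ 6) ^+ 2.
  have -> : K ^+ 63 = (K ^+ 7) ^+ 2 * K ^+ 49 by rewrite -exprM -exprD.
  by move: (K ^+ 7) (K ^+ 49) => *; ring.
by rewrite ler_wpM2l ?ge0.
Qed.

(** Telescoping with b(t) = t^(1/12): factoring b(t+1)^12 - b(t)^12 = 1 gives 1 / (t + 1) <= 12
    (b(t+1) - b(t)). *)
Lemma harmonic_sum_le (R : realType) (m : nat) :
  (\sum_(t < m) (t.+1%:R)^-1 : R) ^+ 12 <= 12 ^+ 12 * m%:R.
Proof.
pose b (t : nat) : R := t%:R `^ 12^-1.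
have b12 t : b t ^+ 12 = t%:R.
  by rewrite -powR_mulrn ?powR_ge0 // /b -powRrM mulVf // powRr1.
have b0 t : 0 <= b t by apply: powR_ge0.
have step t : (t.+1%:R)^-1 <= 12 * (b t.+1 - b t).
  have bt : b t <= b t.+1 by apply: ge0_ler_powR; rewrite ?nnegrE ?ler0n ?invr_ge0 ?ler_nat.
  have b1 : 1 <= b t.+1.
    have <- : 1 `^ 12^-1 = 1 :> R by rewrite powR1.
    by apply: ge0_ler_powR; rewrite ?nnegrE ?ler0n ?invr_ge0 ?ler1n.
  have d : 1 = (b t.+1 - b t) * \sum_(i < 12) b t.+1 ^+ (12.-1 - i) * b t ^+ i.
    by rewrite -subrXX !b12 -natr1 addrAC subrr add0r.
  have le12 : \sum_(i < 12) b t.+1 ^+ (12.-1 - i) * b t ^+ i <= 12 * t.+1%:R.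
    apply: le_trans (_ : _ <= \sum_(i < 12) t.+1%:R) _; last first.
      by rewrite sumr_const card_ord mulr_natl.
    apply: ler_sum => i _; apply: le_trans (_ : _ <= b t.+1 ^+ 11) _.
      have i11 : (i <= 11)%N by rewrite -ltnS.
      have -> : b t.+1 ^+ 11 = b t.+1 ^+ (11 - i) * b t.+1 ^+ i by rewrite -exprD subnK.
      rewrite ler_wpM2l ?exprn_ge0 //.
      by rewrite lerXn2r ?nnegrE.
    by rewrite -(b12 t.+1) ler_weXn2l.
  rewrite -[_^-1]mul1r ler_pdivrMr ?ltr0n // -mulrA mulrCA {1}d ler_wpM2l ?subr_ge0 //.
have sum_le : \sum_(t < m) (t.+1%:R)^-1 <= 12 * b m.
  elim: m => [|m IH]; first by rewrite big_ord0 mulr_ge0.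
  by rewrite big_ord_recr /= (le_trans (lerD IH (step m))) // mulrBr addrC subrK.
rewrite -(b12 m) -exprMn lerXn2r ?nnegrE ?mulr_ge0 //.
by apply: sumr_ge0 => t _; rewrite invr_ge0 ler0n.
Qed.

(** For |A| >= C0 K^3 the energy bound, the quotient bound and Plünnecke's inequality combine;
    smaller sets are covered by the power of K. *)
Lemma shifted_growth (R : realType) : exists2 C : R, 0 < C & forall (A : {fset R}) (K : R),
  (forall a, a \in A -> 0 < a) -> 1 <= K ->
  #|` mulfs A A|%:R <= K * #|` A|%:R ->
  #|` A|%:R ^+ 29 <= C * K ^+ 63 * #|` mulfs (mulfs (shiftfs A) (shiftfs A)) (shiftfs A)|%:R ^+ 14.
Proof.
have [C0 [c1 [C00 c10 hQ]]] : exists C0 c1 : R, [/\ 0 < C0, 0 <= c1 &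
    forall (A : {fset R}) K, (forall a, a \in A -> 0 < a) -> 1 <= K ->
      #|` mulfs A A|%:R <= K * #|` A|%:R -> C0 * K ^+ 3 <= #|` A|%:R ->
      #|` A|%:R ^+ 3 <= c1 * K ^+ 7 * #|` quot43 (shiftfs A)|%:R].
  exists (256 * 260), (60 * (256 * 260) ^+ 2); split; last exact: many_quotients.
    by rewrite mulr_gt0 ?ltr0n.
  by rewrite mulr_ge0 ?exprn_ge0 ?mulr_ge0 ?ler0n.
have [c2 c20 hE] : exists2 c2 : R, 0 <= c2 & forall A : {fset R},
    (forall a, a \in A -> 0 < a) -> #|` A|%:R ^+ 6 <= #|` mulfs (shiftfs A) (shiftfs A)|%:R *
      (c2 * #|` mulfs A A|%:R ^+ 4 * \sum_(t < 2 * #|` mulfs A A|) (t.+1%:R)^-1).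
  by exists 7776; [exact: ler0n | exact: shifted_energy].
have [c3 c30 hH] : exists2 c3 : R, 0 <= c3 &
    forall m, (\sum_(t < 2 * m) (t.+1%:R)^-1 : R) ^+ 12 <= c3 * m%:R.
  exists (12 ^+ 12 * 2); first by rewrite mulr_ge0 ?exprn_ge0 ?ler0n.
  by move=> m; rewrite -mulrA -natrM; apply: harmonic_sum_le.
pose C1 := c1 ^+ 2 * c2 ^+ 12 * c3.
have C10 : 0 <= C1 by rewrite !mulr_ge0 ?exprn_ge0.
exists (C0 ^+ 15 + C1); first by rewrite ltr_wpDr ?exprn_gt0.
move=> A K pA K1 hK; set S := shiftfs A; set T := mulfs (mulfs S S) S.
have K0 : 0 < K by apply: lt_le_trans K1.
have pS s : s \in S -> 0 < s by move=> /imfsetP[a /= /pA a0 ->]; rewrite addr_gt0.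
have [A0|/fset0Pn[a aA]] := eqVneq A fset0.
  rewrite A0 cardfs0 expr0n /= mulr_ge0 ?exprn_ge0 // mulr_ge0 ?exprn_ge0 ?(ltW K0) //.
  by rewrite addr_ge0 ?exprn_ge0 ?(ltW C00).
have aS : a + 1 \in S by apply/imfsetP; exists a.
have S0 : 0 \notin S by apply/negP => /pS; rewrite ltxx.
have SS0 : 0 \notin mulfs S S.
  by apply/negP => /mulfsP[x [y [/pS x0 /pS y0 /eqP]]]; rewrite lt_eqF ?mulr_gt0.
have SSn0 : mulfs S S != fset0 by apply/fset0Pn; exists ((a + 1) * (a + 1)); apply: mem_mulfs.
have cS : #|` S| = #|` A| by apply: card_imfset; apply: addIr.
have nT : (#|` A| <= #|` T|)%N.
  rewrite -cS; have a10 : a + 1 != 0 by rewrite gt_eqF ?pS.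
  exact: leq_trans (card_mulfs_ge _ a10 aS) (card_mulfs_ge _ a10 aS).
have n0 : 0 < #|` A|%:R :> R by rewrite ltr0n cardfs_gt0; apply/fset0Pn; exists a.
have K63 : 0 <= K ^+ 63 * #|` T|%:R ^+ 14 by rewrite mulr_ge0 ?exprn_ge0 // ltW.
rewrite -mulrA mulrDl.
have [hn|hn] := leP (C0 * K ^+ 3) #|` A|%:R.
  apply: le_trans (_ : _ <= C1 * (K ^+ 63 * #|` T|%:R ^+ 14)) _; last first.
    by rewrite lerDr mulr_ge0 // exprn_ge0 // ltW.
  (* Plünnecke's inequality with X = SS, so that XS is the triple product set. *)
  have hP : #|` quot43 S|%:R * #|` mulfs S S|%:R ^+ 6 <= #|` T|%:R ^+ 7 :> R.
    by have := plunnecke_4_3 SS0 S0 SSn0; rewrite -(ler_nat R) natrM !natrX.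
  have H0 : 0 <= \sum_(t < 2 * #|` mulfs A A|) (t.+1%:R)^-1 :> R.
    by apply: sumr_ge0 => t _; rewrite invr_ge0 ler0n.
  rewrite mulrA; exact: (combine_exponents n0 (ler0n _ _) (ltW K0) (ler0n _ _) (ler0n _ _)
    H0 c10 c20 c30 hK hP (hE A pA) (hH _) (hQ A K pA K1 hK hn)).
(* Now |A| < C0 K^3: fifteen factors |A| are bounded by (C0 K^3)^15, with K^45 <= K^63, and the
   other fourteen by the size of [T]. *)
apply: le_trans (_ : _ <= C0 ^+ 15 * (K ^+ 63 * #|` T|%:R ^+ 14)) _; last first.
  by rewrite lerDl mulr_ge0 // ltW.
have -> : #|` A|%:R ^+ 29 = #|` A|%:R ^+ 15 * #|` A|%:R ^+ 14 :> R by rewrite -exprD.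
rewrite mulrA; apply: ler_pM; rewrite ?exprn_ge0 ?ler0n //; last first.
  by rewrite lerXn2r ?nnegrE ?ler0n // ler_nat.
have m0 : 0 <= C0 * K ^+ 3 by rewrite mulr_ge0 ?exprn_ge0 ?ltW.
apply: le_trans (lerXn2r 15 (ltW n0 : _ \in Num.nneg) (m0 : _ \in Num.nneg) (ltW hn)) _.
rewrite exprMn ler_wpM2l ?exprn_ge0 ?(ltW C00) // -exprM.
by apply: ler_weXn2l.
Qed.

Theorem theorem8 :
  exists (c C k : R), 0 < c /\ 0 < C /\ 0 < k /\
    forall (A : {fset R}) (K : R),
      (forall a, a \in A -> 0 < a) ->
      1 <= K ->
      (#|` prodset A A|%:R <= K * #|` A|%:R) ->
      k * ((#|` A|%:R : R) `^ (2 + c)) / (K `^ C)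
        <= (#|` prodset (prodset (shift1 A) (shift1 A)) (shift1 A)|%:R : R).
Proof.
have [C C0 hC] := shifted_growth R.
(* These come from the fourteenth root of [shifted_growth], since 29/14 = 2 + 1/14. *)
exists 14^-1, (63 / 14), (C `^ 14^-1)^-1.
have Cr0 : 0 < C `^ 14^-1 by apply: powR_gt0.
split; first by rewrite invr_gt0.
split; first by rewrite divr_gt0.
split; first by rewrite invr_gt0.
move=> A K pA K1 hK; have K0 : 0 < K by apply: lt_le_trans K1.
have := hC A K pA K1 hK.
rewrite -[mulfs (mulfs (shiftfs A) (shiftfs A)) (shiftfs A)]
  /(prodset (prodset (shift1 A) (shift1 A)) (shift1 A)).
move: #|` A| #|` prodset _ _| => n t h.
have root x m : 0 <= x -> (x ^+ m) `^ 14^-1 = x `^ (m%:R / 14).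
  by move=> x0; rewrite -powR_mulrn // -powRrM.
rewrite ler_pdivrMr ?powR_gt0 // ler_pdivrMl //.
have -> : n%:R `^ (2 + 14^-1) = (n%:R ^+ 29) `^ 14^-1 :> R.
  by rewrite root ?ler0n //; congr (_ `^ _); lra.
rewrite -root ?(ltW K0) //.
have tE : t%:R = (t%:R ^+ 14) `^ 14^-1 :> R.
  by rewrite root ?ler0n // divff // powRr1.
have K63 : 0 <= K ^+ 63 by rewrite exprn_ge0 // ltW.
have t14 : 0 <= t%:R ^+ 14 :> R by rewrite exprn_ge0.
have CtK : 0 <= C * (t%:R ^+ 14 * K ^+ 63) by apply: mulr_ge0 (ltW C0) (mulr_ge0 t14 K63).
rewrite tE -(powRM _ t14 K63) -(powRM _ (ltW C0) (mulr_ge0 t14 K63)).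
apply: ge0_ler_powR; rewrite ?nnegrE ?invr_ge0 ?ler0n ?exprn_ge0 //.
by rewrite [X in C * X]mulrC mulrA.
Qed.
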